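(* Let $\Lambda\subset\mathbb{R}^d$ be a lattice and let $(X_N)_{N\in\mathbb{N}}$ be a sequence of point sets in $\Omega_\Lambda$ which is hyperuniform for small balls. Then $(X_N)_{N\in\mathbb{N}}$ is uniformly distributed on $\Omega_\Lambda$.
   Context: Let $\Lambda=A\mathbb{Z}^d$ be a lattice in $\mathbb{R}^d$, generated by a nonsingular matrix $A=[v_1,\dots,v_d]$, with fundamental domain $\Omega_\Lambda=\{\sum_{j=1}^d\alpha_jv_j:\alpha_j\in[0,1)\}$ of $\mathbb{R}^d/\Lambda$ and co-volume $|\Lambda|=|\det A|$. Let $\mu$ be Lebesgue measure on $\Omega_\Lambda$ normalized so that $\mu(\Omega_\Lambda)=1$, and let $\mathrm{diam}\,\Omega_\Lambda$ be the Euclidean diameter. A sequence of point sets $(X_N)_{N\in\mathbb{N}}$ has $X_N=\{\mathbf{x}_1,\dots,\mathbf{x}_N\}\subset\Omega_\Lambda$ with $\#X_N=N$; the points $\mathbf{x}_j=\mathbf{x}_j^{(N)}$ may depend on $N$. Balls on the torus: indicator functions of balls are $\Lambda$-periodized, i.e. for $\mathbf{x},\mathbf{y}\in\mathbb{R}^d$ and $R\ge 0$ put $\mathbb{1}_{B(\mathbf{x},R)}(\mathbf{y})=\#\{v\in\Lambda:|\mathbf{y}+v-\mathbf{x}|\le R\}$, and $\mathrm{Vol}(B(\mathbf{x},R))=\frac{1}{|\Lambda|}\frac{\pi^{d/2}}{\Gamma(d/2+1)}R^d$ (so this is the $\mu$-mean of $\mathbb{1}_{B(\mathbf{x},R)}$).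 Uniform distribution: $(X_N)$ is uniformly distributed on $\Omega_\Lambda$ if $\lim_{N\to\infty}\frac1N\sum_{j=1}^N\mathbb{1}_{B(\mathbf{x},R)}(\mathbf{x}_j)=\mathrm{Vol}(B(\mathbf{x},R))$ for all $\mathbf{x}\in\mathbb{R}^d$ and $R\in[0,\frac12\mathrm{diam}\,\Omega_\Lambda]$. Number variance: $V(X_N,R)=\int_{\Omega_\Lambda}\big(\sum_{j=1}^N\mathbb{1}_{B(\mathbf{x},R)}(\mathbf{x}_j)-N\,\mathrm{Vol}(B(\mathbf{x},R))\big)^2d\mu(\mathbf{x})$. $(X_N)$ is hyperuniform for small balls if $V(X_N,R_N)=o\big(N\,\mathrm{Vol}(B(\cdot,R_N))\big)$ as $N\to\infty$ for all sequences $(R_N)_{N\in\mathbb{N}}$ of positive radii such that $\lim_{N\to\infty}R_N=0$ and $\lim_{N\to\infty}N\,\mathrm{Vol}(B(\cdot,R_N))=\infty$ (equivalently $R_NN^{1/d}\to\infty$). *)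

(* Defs.v *)
From HB Require Import structures.
From mathcomp Require Import all_boot all_order all_algebra finmap.
From mathcomp Require Import all_classical all_reals all_analysis.

Set Implicit Arguments.
Unset Strict Implicit.
Unset Printing Implicit Defensive.

Import Order.TTheory GRing.Theory Num.Theory.
Import numFieldNormedType.Exports.

Local Open Scope classical_set_scope.
Local Open Scope ring_scope.

(** * Lebesgue measure on R^d

    The product sigma-algebra is the library's one on [d.-tuple]s; the measure
    is the iterated product of the one-dimensional Lebesgue measure, moved
    along the bijection (x, t) |-> x :: t from R * R^n to R^(n+1). *)

Section cons_measure.
Context (dT : measure_display) (T : measurableType dT) (R : realType) (n : nat).

Definition cons_pair (p : T * n.-tuple T) :
  n.+1.-tuple T := [tuple of p.1 :: p.2].

Lemma measurable_cons_pair : measurable_fun setT cons_pair.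
Proof. by apply: measurable_cons; [exact: measurable_fst|exact: measurable_snd]. Qed.

Variables (mu : {sigma_finite_measure set T -> \bar R})
  (m : {sigma_finite_measure set (n.-tuple T) -> \bar R}).

Definition cons_measure : set (n.+1.-tuple T) -> \bar R :=
  pushforward (mu \x m)%E cons_pair.

Let cons_measure0 : cons_measure set0 = 0%E.
Proof. by rewrite /cons_measure /pushforward preimage_set0 measure0. Qed.

Let cons_measure_ge0 A : (0 <= cons_measure A)%E.
Proof. by rewrite /cons_measure /pushforward; exact: measure_ge0. Qed.

Let cons_measure_sigma_additive : semi_sigma_additive cons_measure.
Proof.
move=> F mF tF mUF; rewrite /cons_measure /pushforward preimage_bigcup.
have mp B : measurable B -> measurable (cons_pair @^-1` B).
  by move=> mB; rewrite -[X in measurable X]setTI; exact: measurable_cons_pair.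
apply: measure_semi_sigma_additive.
- by move=> k; exact: mp.
- apply/trivIsetP => /= i j _ _ ij; rewrite -preimage_setI.
  by move/trivIsetP : tF => /(_ _ _ _ _ ij) ->//; rewrite preimage_set0.
- by rewrite -preimage_bigcup; exact: mp.
Qed.

HB.instance Definition _ := isMeasure.Build _ _ _ cons_measure
  cons_measure0 cons_measure_ge0 cons_measure_sigma_additive.

Let cons_measure_sigma_finite : sigma_finite setT cons_measure.
Proof.
have /sigma_finiteP[F [TF ndF Foo]] := sigma_finiteT mu.
have /sigma_finiteP[G [TG ndG Goo]] := sigma_finiteT m.
pose behead_tuple (t : n.+1.-tuple T) : n.-tuple T := [tuple of behead t].
exists (fun k => (fun t => tnth t ord0) @^-1` F k `&` behead_tuple @^-1` G k).
  rewrite predeqE => t; split => // _.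
  have : [set: T] (tnth t ord0) by [].
  have : [set: n.-tuple T] (behead_tuple t) by [].
  rewrite TF TG => -[k _ Gk] [l _ Fl]; exists (maxn l k) => //; split.
    by have /subsetPset := ndF _ _ (leq_maxl l k); exact.
  by have /subsetPset := ndG _ _ (leq_maxr l k); exact.
move=> k; have [mF Fk] := Foo k; have [mG Gk] := Goo k; split.
  apply: measurableI; rewrite -[X in measurable X]setTI.
    exact: measurable_tnth.
  exact: measurable_behead.
rewrite /cons_measure /pushforward.
rewrite (_ : _ @^-1` _ = F k `*` G k).
  by rewrite product_measure1E// lte_mul_pinfty// ge0_fin_numE.
apply/seteqP; split=> -[x t] /=; rewrite (tnth_nth x) /=.
  by move=> [Fx]; rewrite (_ : behead_tuple _ = t) //; exact: val_inj.
by move=> [Fx Gt]; rewrite (_ : behead_tuple _ = t) //; exact: val_inj.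
Qed.

HB.instance Definition _ := Measure_isSigmaFinite.Build _ _ _ cons_measure
  cons_measure_sigma_finite.

End cons_measure.

Fixpoint lebesgue_measure_tuple (R : realType) (d : nat) :
    {sigma_finite_measure set (d.-tuple (measurableTypeR R)) -> \bar R} :=
  match d with
  | 0 => [the {sigma_finite_measure set _ -> \bar R} of
            dirac ([tuple] : 0.-tuple (measurableTypeR R))]
  | n.+1 => [the {sigma_finite_measure set _ -> \bar R} of
            cons_measure lebesgue_measure (lebesgue_measure_tuple R n)]
  end.

Section lattice.
Context (R : realType) (d : nat).
Implicit Types (A : 'M[R]_d) (x y : 'cV[R]_d) (r : R).

Definition cV_of_tuple (t : d.-tuple (measurableTypeR R)) : 'cV[R]_d :=
  \col_i tnth t i.

(* The library's norm on matrices is the sup norm, hence this definition. *)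
Definition enorm x : R := Num.sqrt (\sum_(i < d) x i 0 ^+ 2).

(* The generators v_1, ..., v_d are the columns of A. *)
Definition lattice A : set 'cV[R]_d :=
  [set A *m map_mx intr z | z in [set: 'cV[int]_d]].

Definition fundamental_domain A : set 'cV[R]_d :=
  [set \sum_(j < d) a j *: col j A | a in [set a : 'I_d -> R |
    forall j, 0 <= a j < 1]].

Definition covolume A : R := `|\det A|.

Definition diameter (S : set 'cV[R]_d) : R :=
  sup [set enorm (p.1 - p.2) | p in S `*` S].

(* For nonsingular A the set counted here is finite; [fset_set] would send an
   infinite set to the empty one. *)
Definition ball_count A x r y : nat :=
  #|` fset_set [set v | lattice A v /\ enorm (y + v - x) <= r] |%fset.

End lattice.

Definition Gamma (R : realType) (s : R) : R :=
  \int[lebesgue_measure]_(t in `]0, +oo[) (t `^ (s - 1) * expR (- t)).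

Section hyperuniformity.
Context (R : realType) (d : nat) (A : 'M[R]_d).

Definition ball_vol (r : R) : R :=
  (covolume A)^-1 * (pi `^ (d%:R / 2) / Gamma (d%:R / 2 + 1)) * r ^+ d.

Definition domain_tuples : set (d.-tuple (measurableTypeR R)) :=
  @cV_of_tuple R d @^-1` fundamental_domain A.

Lemma domain_mass_inv_ge0 :
  0 <= (fine (lebesgue_measure_tuple R d domain_tuples))^-1.
Proof. by rewrite invr_ge0 fine_ge0. Qed.

(* Lebesgue measure scaled so as to give mass 1 to the fundamental domain; it
   is only integrated over that domain. *)
Definition domain_measure :
    {measure set (d.-tuple (measurableTypeR R)) -> \bar R} :=
  [the {measure set _ -> \bar R} of
    mscale (NngNum domain_mass_inv_ge0) (lebesgue_measure_tuple R d)].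

Definition point_sets (X : forall N : nat, 'I_N -> 'cV[R]_d) : Prop :=
  forall N, injective (X N) /\ forall j, fundamental_domain A (X N j).

Definition points_in_ball N (X : 'I_N -> 'cV[R]_d) (x : 'cV[R]_d) (r : R) : R :=
  \sum_(j < N) (ball_count A x r (X j))%:R.

Definition uniformly_distributed (X : forall N, 'I_N -> 'cV[R]_d) : Prop :=
  forall (x : 'cV[R]_d) (r : R),
    0 <= r <= diameter (fundamental_domain A) / 2 ->
    (fun N => N%:R^-1 * points_in_ball (X N) x r) @ \oo --> ball_vol r.

Definition number_variance N (X : 'I_N -> 'cV[R]_d) (r : R) : R :=
  \int[domain_measure]_(t in domain_tuples)
    (points_in_ball X (cV_of_tuple t) r - N%:R * ball_vol r) ^+ 2.

Definition hyperuniform_small_balls (X : forall N, 'I_N -> 'cV[R]_d) : Prop :=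
  forall r : nat -> R,
    (forall N, 0 < r N) ->
    r @ \oo --> (0 : R) ->
    (fun N => N%:R * ball_vol (r N)) @ \oo --> +oo ->
    (fun N => number_variance (X N) (r N) : R^o) =o_\oo
      (fun N => N%:R * ball_vol (r N) : R^o).

End hyperuniformity.

(* Main.v *)
(* If V(X_N, R_N) = o(N Vol) along radii R_N -> 0 with N Vol -> oo, then the
   normalized count S_N(x) / (N Vol), where S_N(x) is the number of points in
   B(x, R_N), tends to 1 in L^1 of the torus.  Testing it against the indicator
   of B(x0, r + R_N) bounds the number of points of X_N in B(x0, r) from above,
   since a small ball centered at a point of B(x0, r) lies in B(x0, r + R_N);
   testing against B(x0, r - R_N) bounds it from below.  Both bounds converge to
   N Vol(B(x0, r)).  *)

Require Import Defs.
From mathcomp Require Import all_boot all_order all_algebra finmap.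
From mathcomp Require Import all_classical all_reals all_analysis measurable_realfun.
From mathcomp Require Import zify ring lra.

Set Implicit Arguments.
Unset Strict Implicit.
Unset Printing Implicit Defensive.

Import Order.TTheory GRing.Theory Num.Theory.
Import numFieldNormedType.Exports.

Local Open Scope classical_set_scope.
Local Open Scope ring_scope.

(** * Lebesgue measure of affine preimages and cubes *)

(** [ball_vol] is given by a closed formula with [Gamma], whereas integration over the torus
    produces Lebesgue measures of Euclidean balls. The unit ball is never evaluated: translation and
    scaling of Lebesgue measure give every periodized ball the mean [ball_density A * r ^+ d], and
    the equality of [ball_density A] with the coefficient of [ball_vol] is extracted from
    hyperuniformity itself. The closed formula enters through its positivity, which lets
    [N%:R * ball_vol A (r N)] tend to infinity along suitable radii. A periodized ball may overlap
    itself, so the test functions are counts with multiplicity, bounded by some constant [G], rather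
    than indicators. Inclusions of balls therefore become injections between sets of lattice
    vectors, and integrals over the domain unfold to the whole space. *)

Lemma measurable_forall d (T : measurableType d) (I : finType)
    (P : I -> T -> Prop) :
  (forall i, measurable [set x | P i x]) -> measurable [set x | forall i, P i x].
Proof.
move=> mP; rewrite (_ : mkset _ = \bigcap_(i in [set: I]) [set x | P i x]).
  apply: fin_bigcap_measurable => //; exact: finite_finset.
by apply/seteqP; split => x /= h i; [move=> _; exact: h|exact: h].
Qed.

Lemma measurable_affine (R : realType) (s a : R) :
  measurable_fun [set: measurableTypeR R]
    (fun x => s * x + a : measurableTypeR R).
Proof. by apply: measurable_funD => //; exact: measurable_funM. Qed.

(** Uniqueness of Lebesgue measure: [s] times its image under the affine map has the right value on
    half-open intervals. Keeping the factor on the right avoids dividing extended reals. *)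
Lemma lebesgue_measure_affine (R : realType) (s a : R)
    (B : set (measurableTypeR R)) : 0 < s -> measurable B ->
  lebesgue_measure B =
  (s%:E * lebesgue_measure
     ((fun x => (s * x + a)%R : measurableTypeR R) @^-1` B))%E.
Proof.
move=> s0 mB; have s_ge0 := ltW s0.
pose f := fun x => s * x + a : measurableTypeR R.
apply: (@lebesgue_measure_unique R
  (mscale (NngNum s_ge0) (pushforward lebesgue_measure f))) => //.
  exact: measurable_affine.
move=> mf _ [[u v]] _ <-.
change (lebesgue_measure `]u, v] =
  s%:E * lebesgue_measure (f @^-1` `]u, v]))%E.
have -> : f @^-1` `]u, v] = `](u - a) / s, (v - a) / s]%classic.
  apply/seteqP; split=> x /=; rewrite !in_itv /= /f ltr_pdivrMr// ler_pdivlMr//;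
  by rewrite ltrBlDr lerBrDr [x * s]mulrC.
rewrite !lebesgue_measure_itv /= !lte_fin ltr_pM2r ?invr_gt0//.
rewrite ltrD2r; case: ifP => _; last by rewrite mule0.
by rewrite -EFinM; congr EFin; field; rewrite gt_eqF.
Qed.

Section lebesgue_tuple.
Context (R : realType).
Local Notation T := (measurableTypeR R).

Definition affine_tuple n (s : R) (a : 'I_n -> R) (t : n.-tuple T) : n.-tuple T :=
  [tuple s * tnth t i + a i | i < n].

Lemma measurable_affine_tuple n (s : R) (a : 'I_n -> R) :
  measurable_fun [set: n.-tuple T] (affine_tuple s a).
Proof.
apply/measurable_fun_tnthP => i.
rewrite (_ : _ \o _ = (fun x => s * x + a i : T) \o (@tnth n T ^~ i)).
  by apply: measurableT_comp; [exact: measurable_affine|exact: measurable_tnth].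
by apply/funext => t; rewrite /= tnth_mktuple.
Qed.

Lemma measurable_preimage_affine_tuple n (s : R) (a : 'I_n -> R) (B : set (n.-tuple T)) :
  measurable B -> measurable (affine_tuple s a @^-1` B).
Proof.
by move=> mB; rewrite -[X in measurable X]setTI; exact: measurable_affine_tuple.
Qed.

Lemma affine_tuple_cons n (s : R) (a : 'I_n.+1 -> R) (p : T * n.-tuple T) :
  affine_tuple s a (cons_pair p) =
  cons_pair (s * p.1 + a ord0 : T, affine_tuple s (a \o lift ord0) p.2).
Proof.
apply: eq_from_tnth => i; rewrite tnth_mktuple.
have [j ->|->] := unliftP ord0 i; last by rewrite !(tnth_nth 0).
by rewrite /cons_pair !tnthS tnth_mktuple.
Qed.

(** Induction on the dimension through uniqueness of product measures, checked on rectangles. The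
    case [s = 1] is the translation invariance behind unfolding; the general case gives the scaling
    law for balls. *)
Lemma lebesgue_measure_tuple_affine n (s : R) (a : 'I_n -> R)
    (B : set (n.-tuple T)) : 0 < s -> measurable B ->
  lebesgue_measure_tuple R n B =
  ((s ^+ n)%:E * lebesgue_measure_tuple R n (affine_tuple s a @^-1` B))%E.
Proof.
move=> s0; elim: n a B => [|n IHn] a B mB.
  rewrite expr0 mul1e; congr (lebesgue_measure_tuple R 0 _).
  by apply/seteqP; split => t /=; rewrite [affine_tuple s a t]tuple0 [t]tuple0.
have sn0 : 0 <= s ^+ n.+1 by rewrite exprn_ge0// ltW.
pose f := fun x : T => s * x + a ord0 : T.
pose F := affine_tuple s (a \o lift ord0).
pose G := fun p : T * n.-tuple T => (f p.1, F p.2).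
have mf : measurable_fun setT f by exact: measurable_affine.
have mF : measurable_fun setT F by exact: measurable_affine_tuple.
have mG : measurable_fun setT G.
  apply: measurable_fun_pair.
    by apply: measurableT_comp mf _; exact: measurable_fst.
  by apply: measurableT_comp mF _; exact: measurable_snd.
have mpB : measurable (@cons_pair _ T n @^-1` B).
  by rewrite -[X in measurable X]setTI; exact: measurable_cons_pair.
rewrite /= /cons_measure /pushforward.
rewrite (_ : cons_pair (n:=n) @^-1` (affine_tuple s a @^-1` B) =
  G @^-1` (cons_pair (n:=n) @^-1` B)); last first.
  by apply/seteqP; split => p /=; rewrite affine_tuple_cons.
apply: (@product_measure_unique _ _ _ _ _ lebesgue_measure
  (lebesgue_measure_tuple R n) (mscale (NngNum sn0)
  (pushforward (lebesgue_measure \x lebesgue_measure_tuple R n)%E G))) => //.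
move=> C D mC mD.
change ((s ^+ n.+1)%:E * (lebesgue_measure \x lebesgue_measure_tuple R n)
  (G @^-1` (C `*` D)) = lebesgue_measure C * lebesgue_measure_tuple R n D)%E.
have -> : G @^-1` (C `*` D) = (f @^-1` C) `*` (F @^-1` D) by [].
have mfC : measurable (f @^-1` C) by rewrite -[X in measurable X]setTI; exact: mf.
have mFD : measurable (F @^-1` D) by rewrite -[X in measurable X]setTI; exact: mF.
rewrite product_measure1E// (lebesgue_measure_affine (a ord0) s0 mC).
rewrite (IHn (a \o lift ord0) D mD) exprS EFinM.
by rewrite muleACA.
Qed.

Lemma lebesgue_measure_tuple_cube n (M : R) : 0 <= M ->
  lebesgue_measure_tuple R n [set t | forall i, `|tnth t i| <= M] =
  ((M *+ 2) ^+ n)%:E.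
Proof.
move=> M0; elim: n => [|n IHn].
  by rewrite /= expr0 diracE (_ : _ \in _) // inE => -[].
rewrite /= /cons_measure /pushforward.
rewrite (_ : _ @^-1` _ = `[- M, M]%classic `*`
    [set t : n.-tuple T | forall i, `|tnth t i| <= M]).
  rewrite product_measure1E//.
  - rewrite IHn; have /= -> := lebesgue_measure_itv `[- M, M].
    rewrite exprS EFinM lte_fin opprK -mulr2n; case: ltP => // MM.
    suff -> : M = 0 by rewrite mul0rn.
    by apply/eqP; rewrite eq_le M0 andbT; lra.
  - apply: measurable_forall => i.
    rewrite (_ : [set t | _] = @tnth n T ^~ i @^-1` `[- M, M]).
      by rewrite -[X in measurable X]setTI; exact: measurable_tnth.
    by apply/seteqP; split => t /=; rewrite in_itv /= -ler_norml.
apply/seteqP; split => -[x t] /=; rewrite in_itv /= -ler_norml.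
  move=> h; split; first exact: (h ord0).
  by move=> i; have := h (lift ord0 i); rewrite /cons_pair tnthS.
move=> [hx ht] i; have [j ->|->] := unliftP ord0 i; last by rewrite (tnth_nth 0).
by rewrite /cons_pair tnthS.
Qed.

End lebesgue_tuple.

(** * Euclidean norm, lattice points and the fundamental domain *)

Section euclidean_norm.
Context (R : realType) (d : nat).
Implicit Types (x y : 'cV[R]_d).

Lemma enorm_ge0 x : 0 <= enorm x. Proof. exact: sqrtr_ge0. Qed.

Lemma sumsqr_ge0 x : 0 <= \sum_(i < d) x i 0 ^+ 2.
Proof. by apply: sumr_ge0 => i _; exact: sqr_ge0. Qed.

Lemma sqr_enorm x : enorm x ^+ 2 = \sum_(i < d) x i 0 ^+ 2.
Proof. by rewrite /enorm sqr_sqrtr// sumsqr_ge0. Qed.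

Lemma enormZ (s : R) x : enorm (s *: x) = `|s| * enorm x.
Proof.
rewrite /enorm -sqrtr_sqr -sqrtrM ?sqr_ge0// mulr_sumr; congr Num.sqrt.
by apply: eq_bigr => i _; rewrite !mxE exprMn.
Qed.

Lemma enormN x : enorm (- x) = enorm x.
Proof. by rewrite -scaleN1r enormZ normrN1 mul1r. Qed.

Lemma enorm_coord x i : `|x i 0| <= enorm x.
Proof.
rewrite -sqrtr_sqr ler_sqrt; last exact: sumsqr_ge0.
rewrite (bigD1 i)//= lerDl; apply: sumr_ge0 => j _; exact: sqr_ge0.
Qed.

Lemma enorm_le_sum x : enorm x <= \sum_(i < d) `|x i 0|.
Proof.
have S0 : 0 <= \sum_(i < d) `|x i 0| by apply: sumr_ge0.
rewrite -[leRHS](ger0_norm S0) -sqrtr_sqr ler_sqrt; last exact: sqr_ge0.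
rewrite expr2 mulr_suml; apply: ler_sum => i _.
rewrite -real_normK ?num_real// expr2; apply: ler_wpM2l => //.
by rewrite (bigD1 i)//= lerDl; apply: sumr_ge0.
Qed.

Lemma sum_mul_le_enorm x y :
  \sum_(i < d) x i 0 * y i 0 <= enorm x * enorm y.
Proof.
set C := \sum_(i < d) _.
have [C0|C0] := lerP C 0; first by rewrite (le_trans C0)// mulr_ge0 ?enorm_ge0.
(* Cauchy-Schwarz: the right-hand side is the squared norm of [enorm y ^+ 2 *: x - C *: y],
   expanded. The factor [enorm y ^+ 2] can be cancelled because [C > 0] forces [y] to be nonzero. *)
have key : 0 <= enorm y ^+ 2 * (enorm x ^+ 2 * enorm y ^+ 2 - C ^+ 2).
  have : 0 <= \sum_(i < d) (enorm y ^+ 2 * x i 0 - C * y i 0) ^+ 2.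
    by apply: sumr_ge0 => i _; exact: sqr_ge0.
  rewrite (eq_bigr (fun i => enorm y ^+ 4 * x i 0 ^+ 2 -
    (enorm y ^+ 2 * C *+ 2) * (x i 0 * y i 0) + C ^+ 2 * y i 0 ^+ 2)); last first.
    by move=> i _; ring.
  rewrite big_split/= sumrB -!mulr_sumr -!sqr_enorm -/C.
  by congr (_ <= _); ring.
have y0 : 0 < enorm y.
  rewrite lt_neqAle enorm_ge0 andbT eq_sym; apply/eqP => y0.
  move: C0; rewrite /C big1 ?ltxx// => i _.
  have := enorm_coord y i; rewrite y0 normr_le0 => /eqP ->.
  by rewrite mulr0.
rewrite pmulr_rge0 ?exprn_gt0// subr_ge0 -exprMn in key.
rewrite -(@ler_pXn2r _ 2)// nnegrE; first exact: ltW.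
by rewrite mulr_ge0 ?enorm_ge0.
Qed.

Lemma enormD x y : enorm (x + y) <= enorm x + enorm y.
Proof.
rewrite -(@ler_pXn2r _ 2) ?nnegrE ?addr_ge0 ?enorm_ge0//.
rewrite sqrrD !sqr_enorm.
rewrite (eq_bigr (fun i => x i 0 ^+ 2 + (x i 0 * y i 0) *+ 2 + y i 0 ^+ 2)).
  rewrite !big_split/= lerD2r lerD2l -!mulr2n lerMn2r/=.
  exact: sum_mul_le_enorm.
by move=> i _; rewrite !mxE sqrrD.
Qed.

Lemma enormB x y : enorm (x - y) <= enorm x + enorm y.
Proof. by rewrite -(enormN y); exact: enormD. Qed.

Lemma mulmx_bounded (B : 'M[R]_d) (M : R) : exists C : R,
  forall x, (forall i, `|x i 0| <= M) -> forall i, `|(B *m x) i 0| <= C.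
Proof.
exists (\sum_i \sum_k `|B i k| * M) => x xM i; rewrite mxE.
apply: (le_trans (ler_norm_sum _ _ _)).
rewrite [leRHS](bigD1 i)//= -[leLHS]addr0; apply: lerD.
  by apply: ler_sum => k _; rewrite normrM ler_wpM2l.
apply: sumr_ge0 => j _; apply: sumr_ge0 => k _; rewrite mulr_ge0//.
by rewrite (le_trans _ (xM k)).
Qed.

End euclidean_norm.

Section lattice_geometry.
Context (R : realType) (d : nat) (A : 'M[R]_d).
Implicit Types (x y v w : 'cV[R]_d).

Lemma latticeB v w : lattice A v -> lattice A w -> lattice A (v - w).
Proof.
by move=> [z _ <-] [z' _ <-]; exists (z - z') => //; rewrite map_mxB mulmxBr.
Qed.

Hypothesis Au : A \in unitmx.

Lemma fundamental_domainE x : fundamental_domain A x <->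
  forall j, 0 <= (invmx A *m x) j 0 < 1.
Proof.
split=> [[a a01 <-] j|h].
  rewrite (_ : \sum_j _ = A *m \col_j a j) ?mulKmx ?mxE//.
  apply/colP => i; rewrite summxE mxE; apply: eq_bigr => k _.
  by rewrite !mxE mulrC.
exists (fun j => (invmx A *m x) j 0) => //.
rewrite -[RHS](mulKVmx Au); apply/colP => i; rewrite summxE mxE.
by apply: eq_bigr => k _; rewrite !mxE mulrC.
Qed.

Lemma fundamental_domain_bounded : exists M : R,
  forall x, fundamental_domain A x -> enorm x <= M.
Proof.
have [C hC] := mulmx_bounded A 1; exists (\sum_(i < d) C) => x.
move=> /fundamental_domainE h; apply: (le_trans (enorm_le_sum x)).
apply: ler_sum => i _; rewrite -[x](mulKVmx Au); apply: hC => j.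
by have /andP[h0 h1] := h j; rewrite ger0_norm// ltW.
Qed.

Lemma fundamental_domain_cover x :
  exists2 v, lattice A v & fundamental_domain A (x + v).
Proof.
pose z := \col_j (- Num.floor ((invmx A *m x) j 0)).
exists (A *m map_mx intr z); first by exists z.
apply/fundamental_domainE => j; rewrite mulmxDr mulKmx// !mxE rmorphN/=.
by have := floor_itv ((invmx A *m x) j 0); rewrite mxE intrD; lra.
Qed.

Lemma fundamental_domain_disjoint x v w : lattice A v -> lattice A w ->
  fundamental_domain A (x + v) -> fundamental_domain A (x + w) -> v = w.
Proof.
move=> [z _ <-] [z' _ <-] /fundamental_domainE h /fundamental_domainE h'.
suff -> : z = z' by [].
apply/colP => j; apply/eqP; rewrite eq_le.
move: (h j) (h' j); rewrite !mulmxDr !mulKmx// 4!mxE => hj h'j.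
have lt_int (a b : int) : a%:~R < b%:~R + 1 :> R -> a <= b.
  by move=> ab; rewrite -ltzD1 -(ltr_int R) intrD.
by apply/andP; split; apply: lt_int; rewrite !mxE in hj h'j; lra.
Qed.

(** The inverse of [A] is bounded on bounded sets, so the integer coordinates lie strictly between
    [-m] and [m]; shifting them by [m] embeds the candidates in a finite function type. *)
Lemma finite_lattice_ball (M : R) :
  finite_set [set v | lattice A v /\ enorm v <= M].
Proof.
have [C hC] := mulmx_bounded (invmx A) M.
pose m := Num.bound `|C|.
pose f (g : {ffun 'I_d -> 'I_(m.*2.+1)}) : 'cV[R]_d :=
  A *m map_mx intr (\col_i ((g i)%:Z - m%:Z)).
apply: (@sub_finite_set _ _ (f @` setT)); last exact/finite_image/finite_finset.
move=> _ [[z _ <-] hz].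
have zm i : `|z i 0| < m%:Z.
  have : `|(z i 0)%:~R| <= C :> R.
    have := hC (A *m map_mx intr z) _ i; rewrite mulKmx// mxE; apply => k.
    exact: le_trans (enorm_coord _ k) hz.
  move=> zC; rewrite -(ltr_int R) intr_norm; apply: le_lt_trans zC _.
  rewrite -[(m%:Z)%:~R]/(m%:R).
  by apply: le_lt_trans (ler_norm C) _; exact: archi_boundP (normr_ge0 C).
exists [ffun i => inord (absz (z i 0%R + m%:Z)%R)] => //.
rewrite /f; congr (_ *m map_mx _ _); apply/colP => i; rewrite !mxE ffunE.
have := zm i; rewrite ltr_norml => /andP[zl zr].
rewrite inordK; first by rewrite gez0_abs ?addrK//; lia.
lia.
Qed.

Lemma finite_ball_count x (r : R) y :
  finite_set [set v | lattice A v /\ enorm (y + v - x) <= r].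
Proof.
apply: sub_finite_set (finite_lattice_ball (r + enorm (y - x))) => v [Lv vr].
split=> //; rewrite (_ : v = (y + v - x) - (y - x)).
  by apply: (le_trans (enormB _ _)); rewrite lerD2r.
by rewrite opprB addrA subrK addrC addKr.
Qed.

(** Counts with multiplicity are compared by mapping lattice vectors injectively. Finiteness of both
    sets is what lets cardinals of [fset_set] follow the inclusion. *)
Lemma ball_count_leq (f : 'cV[R]_d -> 'cV[R]_d) x r y x' r' y' :
  injective f ->
  (forall v, lattice A v -> lattice A (f v)) ->
  (forall v, enorm (y + v - x) <= r -> enorm (y' + f v - x') <= r') ->
  (ball_count A x r y <= ball_count A x' r' y')%N.
Proof.
move=> f_inj fL fr; rewrite /ball_count.
have fin := finite_ball_count x r y; have fin' := finite_ball_count x' r' y'.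
set S := [set v | _]; rewrite (_ : #|` fset_set S| = #|` fset_set (f @` S)|)%fset.
  apply: fsubset_leq_card.
  rewrite -fset_set_sub//; last exact: finite_image.
  by move=> _ [v [Lv vr] <-]; split; [exact: fL|exact: fr].
by rewrite fset_set_image// card_imfset.
Qed.

(** The triangle inequality on the torus, with multiplicities. The reflection [w - v] appears
    because [z] changes from center to counted point. *)
Lemma ball_count_center_leq x y z (r e : R) w : lattice A w ->
  enorm (y + w - x) <= e ->
  (ball_count A z r y <= ball_count A x (r + e) z)%N.
Proof.
move=> Lw we; apply: (@ball_count_leq (fun v => w - v)).
- by move=> u v /addrI/oppr_inj.
- by move=> v Lv; exact: latticeB.
move=> v vr; rewrite (_ : _ - x = (y + w - x) - (y + v - z)).
  by apply: (le_trans (enormB _ _)); rewrite addrC lerD.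
by apply/colP => i; rewrite !mxE; ring.
Qed.

Lemma ball_count_point_leq x y z (r e : R) w : lattice A w ->
  enorm (y + w - x) <= e ->
  (ball_count A x r z <= ball_count A z (r + e) y)%N.
Proof.
move=> Lw we; apply: (@ball_count_leq (fun v => w - v)).
- by move=> u v /addrI/oppr_inj.
- by move=> v Lv; exact: latticeB.
move=> v vr; rewrite (_ : _ - z = (y + w - x) - (z + v - x)).
  by apply: (le_trans (enormB _ _)); rewrite addrC lerD.
by apply/colP => i; rewrite !mxE; ring.
Qed.

Lemma ball_count_neq0 x (r : R) y : ball_count A x r y != 0%N ->
  exists2 w, lattice A w & enorm (y + w - x) <= r.
Proof.
move=> /eqP h; apply: contrapT => /forall2NP nw; apply: h.
rewrite /ball_count (_ : [set v | _] = set0) ?fset_set0 ?cardfs0//.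
by apply/seteqP; split => // v /= [Lv vr]; have [] := nw v.
Qed.

Lemma ball_count_sum (K : {fset 'cV[R]_d}) x (r : R) y :
  (forall v, v \in K -> lattice A v) ->
  (forall v, lattice A v -> enorm (y + v - x) <= r -> v \in K) ->
  ball_count A x r y = (\sum_(v <- K) (enorm (y + v - x) <= r)%R)%N.
Proof.
move=> KL LK; rewrite /ball_count.
rewrite (_ : fset_set _ = [fset v in K | enorm (y + v - x) <= r]%fset).
  by rewrite card_fset_sum1 big_fset/= big_mkcond.
apply/fsetP => v; rewrite in_fset_set; last exact: finite_ball_count.
rewrite !inE/=; apply/idP/andP.
  by rewrite inE => -[Lv vr]; split => //; exact: LK.
by move=> [Kv vr]; rewrite inE; split => //; exact: KL.
Qed.

(** Since the domain is bounded, one finite index set serves all centers [x] in it. The count thus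
    becomes a finite sum of indicators in the center, which gives its measurability, its boundedness
    and its integral. *)
Lemma ball_count_index (r : R) y : exists K : {fset 'cV[R]_d},
  (forall v, v \in K -> lattice A v) /\
  forall x v, fundamental_domain A x -> lattice A v ->
    enorm (y + v - x) <= r -> v \in K.
Proof.
have [M hM] := fundamental_domain_bounded.
pose S := [set v | lattice A v /\ enorm v <= r + (enorm y + M)].
have finS : finite_set S by exact: finite_lattice_ball.
exists (fset_set S); split=> [v|x v Ox Lv vr]; rewrite in_fset_set//.
  by rewrite inE => -[].
rewrite inE; split => //; rewrite (_ : v = (y + v - x) - (y - x)).
  apply: (le_trans (enormB _ _)); apply: lerD => //.
  by apply: (le_trans (enormB _ _)); rewrite lerD2l; exact: hM.
by rewrite opprB addrA subrK addrC addKr.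
Qed.

End lattice_geometry.

(** * Unfolding the periodized ball *)

Section domain_integral.
Context (R : realType) (d : nat) (A : 'M[R]_d).
Local Notation T := (d.-tuple (measurableTypeR R)).
Local Notation lambda := (lebesgue_measure_tuple R d).
Local Notation cV := (@cV_of_tuple R d).
Local Notation Omega := (domain_tuples A).

Lemma measurable_fun_le_const (f : T -> R) (r : R) :
  measurable_fun setT f -> measurable [set t | f t <= r].
Proof.
move=> mf; rewrite (_ : mkset _ = f @^-1` `]-oo, r]).
  by rewrite -[X in measurable X]setTI; exact: mf.
by apply/seteqP; split => t /=; rewrite in_itv.
Qed.

Lemma measurable_coord (B : 'M[R]_d) j :
  measurable_fun [set: T] (fun t => (B *m cV t) j 0).
Proof.
rewrite (_ : (fun t => _) = (fun t : T => \sum_k B j k * tnth t k)).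
  apply: measurable_sum => k; apply: measurable_funM => //.
  exact: measurable_tnth.
by apply/funext => t; rewrite mxE; apply: eq_bigr => k _; rewrite mxE.
Qed.

Lemma measurable_enorm (w : 'cV[R]_d) :
  measurable_fun [set: T] (fun t => enorm (w - cV t)).
Proof.
rewrite (_ : (fun t => _) =
    (@Num.sqrt R) \o (fun t : T => \sum_k (w k 0 - tnth t k) ^+ 2)).
  apply: measurableT_comp.
    by apply: continuous_measurable_fun; exact: sqrt_continuous.
  apply: measurable_sum => k; apply: measurable_funX.
  by apply: measurable_funB => //; exact: measurable_tnth.
apply/funext => t; congr Num.sqrt; apply: eq_bigr => k _.
by rewrite !mxE.
Qed.

Definition tuple_ball (w : 'cV[R]_d) (r : R) : set T :=
  [set t | enorm (w - cV t) <= r].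

Lemma measurable_tuple_ball w r : measurable (tuple_ball w r).
Proof. by apply: measurable_fun_le_const; exact: measurable_enorm. Qed.

Lemma cV_of_tuple_affine (s : R) (v : 'cV[R]_d) (t : T) :
  cV (affine_tuple s (fun i => v i 0) t) = s *: cV t + v.
Proof. by apply/colP => i; rewrite !mxE tnth_mktuple. Qed.

Lemma lebesgue_measure_tuple_ball (w : 'cV[R]_d) (r : R) : 0 < r ->
  lambda (tuple_ball w r) = ((r ^+ d)%:E * lambda (tuple_ball 0%R 1))%E.
Proof.
move=> r0; rewrite (lebesgue_measure_tuple_affine (fun i => w i 0) r0);
  last exact: measurable_tuple_ball.
congr (_ * lambda _)%E; apply/seteqP; split=> t /=;
  rewrite /tuple_ball /= cV_of_tuple_affine opprD addrCA subrr addr0 sub0r;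
  rewrite !enormN enormZ gtr0_norm//; first by rewrite ger_pMr.
by move=> h; rewrite ger_pMr.
Qed.

Lemma lebesgue_measure_tuple_unit_ball_lty : (lambda (tuple_ball 0%R 1) < +oo)%E.
Proof.
apply: (@le_lt_trans _ _ (lambda [set t | forall i, `|tnth t i| <= 1])); last first.
  by rewrite lebesgue_measure_tuple_cube// ltry.
apply: le_measure; rewrite ?inE; first exact: measurable_tuple_ball.
  apply: measurable_forall => i; apply: measurable_fun_le_const.
  by apply: measurableT_comp => //; exact: measurable_tnth.
move=> t; rewrite /tuple_ball /= sub0r enormN => h i.
by apply: le_trans h; have := enorm_coord (cV t) i; rewrite mxE.
Qed.

Hypothesis Au : A \in unitmx.

Lemma measurable_domain_tuples : measurable Omega.
Proof.
rewrite (_ : Omega = [set t | forall j, 0 <= (invmx A *m cV t) j 0 < 1]).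
  apply: measurable_forall => j.
  rewrite (_ : mkset _ = (fun t => (invmx A *m cV t) j 0) @^-1` `[0, 1[).
    by rewrite -[X in measurable X]setTI; exact: measurable_coord.
  by apply/seteqP; split => t /=; rewrite in_itv.
by apply/seteqP; split => t /=; move/(fundamental_domainE Au).
Qed.

Lemma measurable_translated_domain (v : 'cV[R]_d) :
  measurable [set t : T | fundamental_domain A (cV t + v)].
Proof.
rewrite (_ : mkset _ = affine_tuple 1 (fun i => v i 0) @^-1` Omega).
  by apply: measurable_preimage_affine_tuple; exact: measurable_domain_tuples.
by apply/seteqP; split => t /=; rewrite /domain_tuples /= cV_of_tuple_affine scale1r.
Qed.

Lemma ball_count_indic (y : 'cV[R]_d) (r : R) : exists K : {fset 'cV[R]_d},
  [/\ forall v, v \in K -> lattice A v,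
      forall x v, fundamental_domain A x -> lattice A v ->
        enorm (y + v - x) <= r -> v \in K &
      forall t, Omega t -> (ball_count A (cV t) r y)%:R =
        \sum_(v <- K) \1_(tuple_ball (y + v) r) t :> R].
Proof.
have [K [KL LK]] := ball_count_index Au r y; exists K; split => // t Ot.
rewrite (ball_count_sum Au KL); last by move=> v; exact: LK.
rewrite natr_sum; apply: eq_bigr => v _.
rewrite indicE; congr (_%:R); congr nat_of_bool.
by apply/idP/idP => [h|]; rewrite inE.
Qed.

Lemma measurable_ball_count (y : 'cV[R]_d) (r : R) :
  measurable_fun Omega (fun t => (ball_count A (cV t) r y)%:R : R).
Proof.
have [K [_ _ KE]] := ball_count_indic y r.
apply: (eq_measurable_fun (fun t : T => \sum_(v <- K) \1_(tuple_ball (y + v) r) t : R)).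
  by move=> t; rewrite inE => Ot; rewrite KE.
apply: measurable_sum => v; apply: measurable_indic.
exact: measurable_tuple_ball.
Qed.

Lemma ball_count_bounded (y : 'cV[R]_d) (r : R) : exists M : R,
  forall t, Omega t -> (ball_count A (cV t) r y)%:R <= M.
Proof.
have [K [_ _ KE]] := ball_count_indic y r.
exists (\sum_(v <- K) 1) => t Ot; rewrite KE//; apply: ler_sum => v _.
by rewrite indicE lern1 leq_b1.
Qed.

(* The translates of the domain by the lattice tile space, so that the
   integral of the periodization over the domain unfolds to the whole ball. *)
Lemma integral_ball_count (y : 'cV[R]_d) (r : R) :
  (\int[lambda]_(t in Omega) (ball_count A (cV t) r y)%:R%:E =
   lambda (tuple_ball y r))%E.
Proof.
have mOmega := measurable_domain_tuples.
have [K [KL LK KE]] := ball_count_indic y r.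
transitivity (\int[lambda]_(t in Omega)
    (\sum_(v <- K) (\1_(tuple_ball (y + v) r) t)%:E))%E.
  by apply: eq_integral => t; rewrite inE => Ot; rewrite KE// sumEFin.
rewrite ge0_integral_sum//=; last first.
  move=> v; apply/measurable_EFinP; apply: measurable_indic.
  exact: measurable_tuple_ball.
(* [F v] is the piece of the ball that translation by [v] carries onto the part of
   [tuple_ball (y + v) r] inside [Omega]. The pieces are disjoint and fill the ball, as each point
   has exactly one lattice translate in the domain. *)
pose F (v : 'cV[R]_d) := tuple_ball y r `&` [set t | fundamental_domain A (cV t + v)].
have mF v : measurable (F v).
  by apply: measurableI; [exact: measurable_tuple_ball|
    exact: measurable_translated_domain].
transitivity (\sum_(v <- K) lambda (F v))%E.
  apply: eq_bigr => v _; rewrite integral_indic//; last exact: measurable_tuple_ball.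
  rewrite -[LHS]/(lambda (tuple_ball (y + v) r `&` Omega)).
  rewrite (lebesgue_measure_tuple_affine (fun i => v i 0)
    (B := tuple_ball (y + v) r `&` Omega) ltr01); last first.
    by apply: measurableI => //; exact: measurable_tuple_ball.
  rewrite expr1n mul1e; congr (lambda _); apply/seteqP.
  by split=> t; rewrite /F /tuple_ball /domain_tuples /= cV_of_tuple_affine scale1r
    opprD addrACA subrr addr0.
rewrite -measure_fbigsetU//; last first.
  move=> v w Kv Kw [t [[_ tv] [_ tw]]].
  by apply: (fundamental_domain_disjoint Au) tv tw; exact: KL.
rewrite -bigcup_fset; congr (lambda _); apply/seteqP; split=> [t [v _ []]//|t ht].
have [v Lv tv] := fundamental_domain_cover Au (cV t).
exists v; last by [].
apply: LK tv Lv _; rewrite opprD addrACA subrr addr0; exact: ht.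
Qed.

Lemma lebesgue_measure_domain_lty : (lambda Omega < +oo)%E.
Proof.
have [M hM] := fundamental_domain_bounded Au.
apply: (@le_lt_trans _ _ (lambda (tuple_ball 0%R (`|M| + 1)))).
  apply: le_measure; rewrite ?inE; first exact: measurable_domain_tuples.
    exact: measurable_tuple_ball.
  move=> t /hM h; rewrite /tuple_ball /= sub0r enormN; apply: le_trans h _.
  by rewrite (le_trans (ler_norm M))// lerDl.
rewrite lebesgue_measure_tuple_ball ?ltr_wpDl//.
rewrite lte_mul_pinfty ?lee_fin ?exprn_ge0 ?addr_ge0//.
exact: lebesgue_measure_tuple_unit_ball_lty.
Qed.

(** Unfolding replaces a determinant computation: over a null domain every periodized ball would
    integrate to zero, hence every ball would be null. The ball of radius [d] contains the cube with
    coordinates in [-1, 1], of measure [2 ^+ d]. *)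
Lemma lebesgue_measure_domain_gt0 : (0 < lambda Omega)%E.
Proof.
have mOmega := measurable_domain_tuples.
rewrite lt0e measure_ge0 andbT; apply/eqP => O0.
have ball0 : lambda (tuple_ball 0%R d%:R) = 0%E.
  rewrite -integral_ball_count null_set_integral//.
  by apply/measurable_EFinP; exact: measurable_ball_count.
have : (lambda [set t | forall i, (`|tnth t i| <= 1)%R] <= 0)%E.
  rewrite -ball0; apply: le_measure; rewrite ?inE.
  - apply: measurable_forall => i; apply: measurable_fun_le_const.
    by apply: measurableT_comp => //; exact: measurable_tnth.
  - exact: measurable_tuple_ball.
  - move=> t /= h; rewrite /tuple_ball /= sub0r enormN.
    apply: (le_trans (enorm_le_sum _)).
    rewrite (_ : d%:R = \sum_(i < d) 1); last by rewrite sumr_const card_ord.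
    by apply: ler_sum => i _; rewrite mxE.
rewrite lebesgue_measure_tuple_cube// lee_fin leNgt.
by rewrite exprn_gt0// mulrn_wgt0.
Qed.

End domain_integral.

(** * Means over the fundamental domain *)

Section mean.
Context (R : realType) (d : nat) (A : 'M[R]_d).
Local Notation T := (d.-tuple (measurableTypeR R)).
Local Notation lambda := (lebesgue_measure_tuple R d).
Local Notation cV := (@cV_of_tuple R d).
Local Notation Omega := (domain_tuples A).
Local Notation mu := (domain_measure A).

Hypothesis Au : A \in unitmx.

Lemma domain_measureE (B : set T) :
  mu B = ((fine (lambda Omega))^-1%:E * lambda B)%E.
Proof. by []. Qed.

Lemma fine_lebesgue_measure_domain_gt0 : 0 < fine (lambda Omega).
Proof.
by rewrite fine_gt0// lebesgue_measure_domain_gt0// lebesgue_measure_domain_lty.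
Qed.

Lemma domain_measure_domain : mu Omega = 1%E.
Proof.
rewrite domain_measureE -[X in (_ * X)%E]fineK.
  by rewrite -EFinM mulVf// gt_eqF// fine_lebesgue_measure_domain_gt0.
by rewrite ge0_fin_numE//; exact: lebesgue_measure_domain_lty.
Qed.

(** On a domain of mass 1 these functions are integrable, and they are closed under sums and
    products; all integrands below belong to this class. *)
Definition bounded_measurable (f : T -> R) :=
  measurable_fun Omega f /\ exists M, forall t, Omega t -> `|f t| <= M.

Lemma bounded_measurable_integrable f :
  bounded_measurable f -> mu.-integrable Omega (EFin \o f).
Proof.
move=> [mf [M fM]]; apply: measurable_bounded_integrable => //.
- exact: measurable_domain_tuples.
- by rewrite domain_measure_domain ltry.
- exists M; split; first exact: num_real.
  by move=> x Mx t Ot; apply: le_trans (fM t Ot) (ltW Mx).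
Qed.

Lemma bounded_measurable_cst k : bounded_measurable (fun=> k).
Proof. by split => //; exists `|k|. Qed.

Lemma bounded_measurableD f g : bounded_measurable f -> bounded_measurable g ->
  bounded_measurable (fun t => f t + g t).
Proof.
move=> [mf [M fM]] [mg [M' gM]]; split; first exact: measurable_funD.
exists (M + M') => t Ot; apply: (le_trans (ler_normD _ _)).
by apply: lerD; [exact: fM|exact: gM].
Qed.

Lemma bounded_measurableM f g : bounded_measurable f -> bounded_measurable g ->
  bounded_measurable (fun t => f t * g t).
Proof.
move=> [mf [M fM]] [mg [M' gM]]; split; first exact: measurable_funM.
exists (M * M') => t Ot; rewrite normrM.
by apply: ler_pM => //; [exact: fM|exact: gM].
Qed.

Lemma bounded_measurable_sum (I : Type) (s : seq I) (f : I -> T -> R) :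
  (forall i, bounded_measurable (f i)) ->
  bounded_measurable (fun t => \sum_(i <- s) f i t).
Proof.
move=> bf; elim: s => [|i s IHs].
  rewrite (_ : (fun t => _) = fun=> 0); first exact: bounded_measurable_cst.
  by apply/funext => t; rewrite big_nil.
rewrite (_ : (fun t => _) = fun t => f i t + \sum_(j <- s) f j t).
  exact: bounded_measurableD.
by apply/funext => t; rewrite big_cons.
Qed.

Lemma bounded_measurable_ball_count (y : 'cV[R]_d) (r : R) :
  bounded_measurable (fun t => (ball_count A (cV t) r y)%:R).
Proof.
split; first exact: measurable_ball_count.
have [M hM] := ball_count_bounded Au y r.
by exists M => t Ot; rewrite ger0_norm//; exact: hM.
Qed.

(** The actual normalized volume of the unit ball, kept apart from the closed formula in [ball_vol]
    until [ball_vol_density] identifies the two constants. *)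
Definition ball_density : R := fine (lambda (tuple_ball 0 1)) / fine (lambda Omega).

Lemma mean_ball_count (y : 'cV[R]_d) (r : R) : 0 < r ->
  \int[mu]_(t in Omega) (ball_count A (cV t) r y)%:R = ball_density * r ^+ d.
Proof.
move=> r0; rewrite /Rintegral ge0_integral_mscale//; last first.
- by apply/measurable_EFinP; exact: measurable_ball_count.
- exact: measurable_domain_tuples.
rewrite integral_ball_count// lebesgue_measure_tuple_ball//= fineM//; last first.
  rewrite fin_numM// ge0_fin_numE//; exact: lebesgue_measure_tuple_unit_ball_lty.
rewrite fineM//; last first.
  rewrite ge0_fin_numE//; exact: lebesgue_measure_tuple_unit_ball_lty.
by rewrite /= /ball_density; ring.
Qed.

Lemma mean_cst k : \int[mu]_(t in Omega) k = k.
Proof.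
rewrite Rintegral_cst; last exact: measurable_domain_tuples.
by rewrite domain_measure_domain mulr1.
Qed.

Lemma meanD f g : bounded_measurable f -> bounded_measurable g ->
  \int[mu]_(t in Omega) (f t + g t) =
  \int[mu]_(t in Omega) f t + \int[mu]_(t in Omega) g t.
Proof.
move=> bf bg; apply: RintegralD; first exact: measurable_domain_tuples.
- exact: bounded_measurable_integrable.
- exact: bounded_measurable_integrable.
Qed.

Lemma meanZl k f : bounded_measurable f ->
  \int[mu]_(t in Omega) (k * f t) = k * \int[mu]_(t in Omega) f t.
Proof.
move=> bf; apply: RintegralZl; first exact: measurable_domain_tuples.
exact: bounded_measurable_integrable.
Qed.

Lemma le_mean f g : bounded_measurable f -> bounded_measurable g ->
  (forall t, Omega t -> f t <= g t) ->
  \int[mu]_(t in Omega) f t <= \int[mu]_(t in Omega) g t.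
Proof.
move=> bf bg fg; apply: le_Rintegral => //; first exact: measurable_domain_tuples.
- exact: bounded_measurable_integrable.
- exact: bounded_measurable_integrable.
Qed.

Lemma mean_sum (I : Type) (s : seq I) (f : I -> T -> R) :
  (forall i, bounded_measurable (f i)) ->
  \int[mu]_(t in Omega) (\sum_(i <- s) f i t) =
  \sum_(i <- s) \int[mu]_(t in Omega) f i t.
Proof.
move=> bf; elim: s => [|i s IHs].
  rewrite big_nil -[RHS](mean_cst 0); apply: eq_Rintegral => t _.
  by rewrite big_nil.
rewrite big_cons -IHs -meanD//; last exact: bounded_measurable_sum.
by apply: eq_Rintegral => t _; rewrite big_cons.
Qed.

(** * Counts in small balls tested against bounded functions *)

Section point_set.
Context (N : nat) (X : 'I_N -> 'cV[R]_d) (e : R).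
Hypothesis e0 : 0 < e.
Local Notation S t := (points_in_ball A X (cV t) e).
Local Notation n := (N%:R * ball_vol A e).

Lemma bounded_measurable_points_in_ball : bounded_measurable (fun t => S t).
Proof.
apply: bounded_measurable_sum => j; exact: bounded_measurable_ball_count.
Qed.

(** The mean of a periodized ball is independent of the point at which it is evaluated, so a
    weighted sum over the points becomes an integral over the centers [t], where pointwise
    comparisons apply. *)
Lemma mean_weighted_points (c : 'I_N -> R) :
  \int[mu]_(t in Omega) (\sum_(j < N) c j * (ball_count A (cV t) e (X j))%:R) =
  ball_density * e ^+ d * \sum_(j < N) c j.
Proof.
rewrite mean_sum => [|j]; last first.
  apply: bounded_measurableM; first exact: bounded_measurable_cst.
  exact: bounded_measurable_ball_count.
rewrite mulr_sumr; apply: eq_bigr => j _.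
rewrite meanZl; last exact: bounded_measurable_ball_count.
by rewrite mean_ball_count// mulrC.
Qed.

(* Small variance makes the normalized count close to 1 in L^1: pointwise
   [|S - n| <= eta n + (S - n)^2 / (eta n)]. *)
Lemma mean_mul_points_in_ball (h : T -> R) (G eta : R) :
  bounded_measurable h -> (forall t, Omega t -> 0 <= h t <= G) ->
  0 < n -> 0 < eta -> number_variance A X e <= eta ^+ 2 * n ^+ 2 ->
  `|\int[mu]_(t in Omega) (h t * S t) - n * \int[mu]_(t in Omega) h t|
    <= 2 * G * eta * n.
Proof.
move=> bh hG n0 eta0 V.
have bS := bounded_measurable_points_in_ball.
have G0 : 0 <= G.
  (* The sign of [G] is read off at a point of [Omega]; a lattice translate of the origin supplies
     one. *)
  have [v _ Ov] := fundamental_domain_cover Au 0.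
  pose t : T := [tuple (0 + v) i 0 | i < d].
  have -> // : 0 <= G.
  have /andP[] : 0 <= h t <= G.
    apply: hG; rewrite /domain_tuples /= (_ : cV t = 0 + v)//.
    by apply/colP => i; rewrite mxE tnth_mktuple.
  exact: le_trans.
pose Q t := G * (eta * n) + G * (eta * n)^-1 * (S t - n) ^+ 2.
have bQ2 : bounded_measurable (fun t => (S t - n) ^+ 2).
  by apply: bounded_measurableM; apply: bounded_measurableD => //;
    exact: bounded_measurable_cst.
have bQ' : bounded_measurable (fun t => G * (eta * n)^-1 * (S t - n) ^+ 2).
  by apply: bounded_measurableM => //; exact: bounded_measurable_cst.
have bQ : bounded_measurable Q.
  by apply: bounded_measurableD => //; exact: bounded_measurable_cst.
have EQ : \int[mu]_(t in Omega) Q t <= 2 * G * eta * n.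
  rewrite meanD//; last exact: bounded_measurable_cst.
  rewrite mean_cst meanZl// -[X in _ + _ * X]/(number_variance A X e).
  (* The variance bound makes the quadratic term contribute at most [G * eta * n], the same amount
     as the constant term, whence the factor 2. *)
  rewrite (_ : 2 * G * eta * n = G * (eta * n) +
    G * (eta * n)^-1 * (eta ^+ 2 * n ^+ 2)); last first.
    by move: n0; set m := n => n0; field; rewrite !gt_eqF.
  rewrite lerD2l ler_wpM2l// mulr_ge0// invr_ge0 ltW// mulr_gt0//.
have bhS : bounded_measurable (fun t => h t * S t) by exact: bounded_measurableM.
have bnh : bounded_measurable (fun t => n * h t).
  by apply: bounded_measurableM => //; exact: bounded_measurable_cst.
have QE t : Omega t -> `|h t * S t - n * h t| <= Q t.
  move=> Ot; have /andP[h0 hG'] := hG t Ot.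
  rewrite (mulrC n) -mulrBr normrM (ger0_norm h0).
  rewrite /Q -mulrA -mulrDr; apply: ler_pM => //.
  set a := S t - n; rewrite -(@real_normK _ a) ?num_real//.
  have m0 : 0 < eta * n by rewrite mulr_gt0.
  (* A small deviation is covered by the constant term; a deviation larger than [eta * n] is at most
     its square divided by [eta * n]. *)
  have [am|ma] := lerP `|a| (eta * n).
    by rewrite (le_trans am)// lerDl mulr_ge0 ?sqr_ge0// invr_ge0 ltW.
  rewrite -[leLHS]add0r; apply: lerD; first exact: ltW.
  rewrite mulrC ler_pdivlMr// expr2 ler_wpM2l// ltW//.
rewrite -meanZl// ler_distl; apply/andP; split.
  rewrite lerBlDr; apply: (@le_trans _ _ (\int[mu]_(t in Omega) (h t * S t + Q t))).
    apply: le_mean => //; first exact: bounded_measurableD.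
    by move=> t /QE; rewrite ler_distl lerBlDr => /andP[].
  by rewrite meanD// lerD2l.
apply: (@le_trans _ _ (\int[mu]_(t in Omega) (n * h t + Q t))).
  apply: le_mean => //; first exact: bounded_measurableD.
  by move=> t /QE; rewrite ler_distl => /andP[].
by rewrite meanD// lerD2l.
Qed.

Lemma points_in_ball_upper (x : 'cV[R]_d) (r : R) :
  ball_density * e ^+ d * points_in_ball A X x r <=
  \int[mu]_(t in Omega) ((ball_count A (cV t) (r + e) x)%:R * S t).
Proof.
rewrite -mean_weighted_points; apply: le_mean.
- apply: bounded_measurable_sum => j; apply: bounded_measurableM.
    exact: bounded_measurable_cst.
  exact: bounded_measurable_ball_count.
- apply: bounded_measurableM; first exact: bounded_measurable_ball_count.
  exact: bounded_measurable_points_in_ball.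
move=> t _; rewrite mulr_sumr; apply: ler_sum => j _.
(* If no translate of [X j] is within [e] of the center, both terms vanish; otherwise [w] witnesses
   the closeness needed to enlarge the radius by [e]. *)
have [->|/(ball_count_neq0) [w Lw wE]] := eqVneq (ball_count A (cV t) e (X j)) 0%N.
  by rewrite !mulr0.
by rewrite ler_wpM2r// ler_nat; exact: ball_count_center_leq wE.
Qed.

Lemma points_in_ball_lower (x : 'cV[R]_d) (r : R) :
  \int[mu]_(t in Omega) ((ball_count A (cV t) r x)%:R * S t) <=
  ball_density * e ^+ d * points_in_ball A X x (r + e).
Proof.
rewrite -mean_weighted_points; apply: le_mean.
- apply: bounded_measurableM; first exact: bounded_measurable_ball_count.
  exact: bounded_measurable_points_in_ball.
- apply: bounded_measurable_sum => j; apply: bounded_measurableM.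
    exact: bounded_measurable_cst.
  exact: bounded_measurable_ball_count.
move=> t _; rewrite mulr_sumr; apply: ler_sum => j _.
have [->|/(ball_count_neq0) [w Lw wE]] := eqVneq (ball_count A (cV t) e (X j)) 0%N.
  by rewrite !mulr0.
by rewrite ler_wpM2r// ler_nat; exact: ball_count_point_leq wE.
Qed.

End point_set.
End mean.

(** * Positivity of the Gamma function *)

(** This is [ln u <= u - 1] at [u = t / (2 * a)], multiplied by [a]. The scale [2 * a] leaves half
    of the decay of [expR (- t)] for integrability. *)
Lemma powR_le_expR (R : realType) (a t : R) : 0 < a -> 0 < t ->
  t `^ a <= (2 * a) `^ a * expR (t / 2).
Proof.
move=> a0 t0; have a20 : 0 < 2 * a by rewrite mulr_gt0.
rewrite /powR !gt_eqF// -expRD ler_expR.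
have t2 : 0 < t / (2 * a) by rewrite divr_gt0.
have : ln (1 + (t / (2 * a) - 1)) <= t / (2 * a) - 1 by apply: le_ln1Dx; lra.
rewrite addrCA subrr addr0 ln_div ?posrE// => h.
have : a * (ln t - ln (2 * a)) <= a * (t / (2 * a)).
  by rewrite ler_wpM2l//; [exact: ltW|lra].
rewrite (_ : a * (t / (2 * a)) = t / 2); last by field; rewrite gt_eqF.
by lra.
Qed.

(** Integrability matters because the real integral is [fine] of an extended one, so divergence
    would give the value 0. An exponential density dominates the integrand, and the part over [1, 2]
    bounds the integral from below. *)
Lemma Gamma_gt0 (R : realType) (a : R) : 0 < a -> 0 < Gamma (a + 1).
Proof.
move=> a0; rewrite /Gamma addrK.
pose f (t : R) := t `^ a * expR (- t).
have f0 t : 0 <= f t by rewrite mulr_ge0 ?powR_ge0 ?expR_ge0.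
have mf : measurable_fun setT f.
  apply: measurable_funM; first exact: measurable_powR.
  by apply: measurableT_comp; [exact: measurable_expR|exact: oppr_measurable].
have mI : measurable (`]0, +oo[%classic : set (measurableTypeR R)) by [].
have intf : lebesgue_measure.-integrable `]0, +oo[ (EFin \o f).
  (* The factor 2 cancels the rate [2^-1] in front of the density. *)
  pose g := fun x : R => 2 * (2 * a) `^ a * exponential_pdf 2^-1 x.
  apply: (@le_integrable _ _ _ _ _ mI _ (EFin \o g)).
  - by apply/measurable_EFinP; exact: measurable_funTS.
  - move=> t /=; rewrite in_itv/= andbT => t0.
    rewrite lee_fin !ger0_norm//; last first.
      by rewrite /g mulr_ge0 ?mulr_ge0 ?powR_ge0 ?exponential_pdf_ge0 ?invr_ge0.
    rewrite /g exponential_pdfE//; last exact: ltW.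
    rewrite (_ : 2 * (2 * a) `^ a * _ =
      (2 * a) `^ a * expR (t / 2) * expR (- t)).
      by rewrite /f ler_wpM2r ?expR_ge0// powR_le_expR.
    rewrite -[RHS]mulrA -expRD (_ : t / 2 - t = - 2^-1 * t); last by lra.
    by set E := expR _; lra.
  - apply: (@integrableS _ _ _ _ setT) => //.
    rewrite (_ : EFin \o g = fun x => (2 * (2 * a) `^ a)%:E *
      (EFin \o exponential_pdf 2^-1) x)%E; last by apply/funext.
    by apply: integrableZl => //; apply: integrable_exponential_pdf.
apply: (@lt_le_trans _ _ (\int[lebesgue_measure]_(t in `[1%R, 2]) expR (- 2))).
  rewrite Rintegral_cst//.
  have /= -> := lebesgue_measure_itv (`[1, 2] : interval R).
  by rewrite lte_fin ltr1n -EFinB /= mulr_gt0 ?expR_gt0//; lra.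
rewrite /Rintegral fine_le//.
- rewrite integral_cst//; have /= -> := lebesgue_measure_itv (`[1, 2] : interval R).
  by rewrite lte_fin ltr1n -EFinB.
- exact: integrable_fin_num.
apply: (@le_trans _ _ (\int[lebesgue_measure]_(t in `[1%R, 2%R]) (f t)%:E)%E).
  apply: ge0_le_integral => //.
    by apply/measurable_EFinP; exact: measurable_funTS.
  move=> t /=; rewrite in_itv/= => /andP[t1 t2]; rewrite lee_fin.
  rewrite -[leLHS]mul1r; apply: ler_pM; rewrite ?expR_ge0//.
    rewrite (_ : 1 = 1 `^ a); last by rewrite powR1.
    by rewrite ge0_ler_powR ?nnegrE//; [exact: ltW|lra].
  by rewrite ler_expR lerN2.
apply: ge0_subset_integral => //.
- by apply/measurable_EFinP; exact: measurable_funTS.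
- by move=> t _; rewrite lee_fin.
- by move=> t /=; rewrite !in_itv/= => /andP[t1 _]; rewrite andbT; lra.
Qed.

(** * From the variance to the counts *)

(** The witness satisfies [r N ^+ d = 1 / sqrt (N + 1)], so the expected number of points grows like
    the square root of [N]. The shift by one keeps the radius positive at [N = 0]. *)
Lemma mesoscopic_radii (R : realType) (d : nat) : (0 < d)%N ->
  exists r : nat -> R, [/\ forall N, 0 < r N, r @ \oo --> (0 : R) &
    (fun N => N%:R * r N ^+ d) @ \oo --> +oo].
Proof.
move=> d0; pose s N : R := Num.sqrt N.+1%:R.
have s0 N : 0 < s N by rewrite sqrtr_gt0 ltr0n.
have s2 N : s N ^+ 2 = N%:R + 1 by rewrite sqr_sqrtr// natr1.
pose r N : R := (s N)^-1 `^ d%:R^-1.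
have r0 N : 0 < r N by rewrite powR_gt0 ?invr_gt0.
have rd N : r N ^+ d = (s N)^-1.
  rewrite -powR_mulrn ?powR_ge0// -powRrM mulVf ?pnatr_eq0 ?lt0n_neq0// powRr1//.
  by rewrite invr_ge0 ltW.
exists r; split => //.
- apply/cvgrPdist_le => eps eps0; near=> N.
  rewrite sub0r normrN gtr0_norm// -(@ler_pXn2r _ d)// ?nnegrE ?(ltW (r0 _)) ?(ltW eps0)//.
  rewrite rd.
  rewrite -[leRHS]invrK lef_pV2 ?posrE ?invr_gt0 ?exprn_gt0//.
  rewrite -(@ler_pXn2r _ 2)// ?nnegrE ?invr_ge0 ?exprn_ge0 ?(ltW (s0 _)) ?(ltW eps0)//.
  rewrite s2; apply: ler_wpDr => //.
  by near: N; exact: nbhs_infty_ger.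
- apply/cvgryPge => M; near=> N.
  rewrite rd ler_pdivlMr//.
  have N1 : 1 <= N%:R :> R by near: N; exact: nbhs_infty_ger.
  have NM : (2 * M) ^+ 2 <= N%:R by near: N; exact: nbhs_infty_ger.
  have : `|2 * M| <= s N.
    rewrite -(@ler_pXn2r _ 2)// ?nnegrE// ?(ltW (s0 _))// real_normK ?num_real// s2.
    by rewrite (le_trans NM)// lerDl.
  move=> /(le_trans (ler_norm _)) Ms.
  have : 2 * M * s N <= s N ^+ 2 by rewrite expr2 ler_wpM2r// ltW.
  by rewrite s2; lra.
Unshelve. all: by end_near. Qed.

Section main.
Context (R : realType) (d : nat) (A : 'M[R]_d).
Local Notation T := (d.-tuple (measurableTypeR R)).
Local Notation cV := (@cV_of_tuple R d).
Local Notation Omega := (domain_tuples A).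

Hypotheses (Au : A \in unitmx) (d0 : (0 < d)%N).

Let c : R := (covolume A)^-1 * (pi `^ (d%:R / 2) / Gamma (d%:R / 2 + 1)).

Lemma ball_vol_coef_gt0 : 0 < c.
Proof.
rewrite mulr_gt0//.
  by rewrite invr_gt0 normr_gt0 -unitfE -unitmxE.
by rewrite divr_gt0 ?powR_gt0 ?pi_gt0// Gamma_gt0// divr_gt0// ltr0n.
Qed.

Variables (X : forall N, 'I_N -> 'cV[R]_d).
Arguments X : clear implicits.
Hypothesis hyp : hyperuniform_small_balls A X.

(* The normalization of [ball_vol] need not be computed: a wrong constant
   would by itself contribute a variance of order [(N ball_vol)^2]. *)
Lemma ball_vol_density (e : nat -> R) : (forall N, 0 < e N) ->
  (forall eta, 0 < eta -> \forall N \near \oo, 0 < N%:R * ball_vol A (e N) /\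
   number_variance A (X N) (e N) <= eta ^+ 2 * (N%:R * ball_vol A (e N)) ^+ 2) ->
  ball_density A = c.
Proof.
move=> e0 small; have c0 := ball_vol_coef_gt0.
apply/eqP; rewrite -subr_eq0 -normr_le0; apply/ler_addgt0Pl => eps eps0.
rewrite addr0.
(* A single good [N] suffices for each [eps]. Testing against the constant 1 gives the error
   [2 * eta * n] with [n = c * N%:R * e N ^+ d], and this choice of [eta] turns it into
   [eps * (N%:R * e N ^+ d)]. *)
have [|N [n0 V]] := (@filter_ex _ _ _ _ (small (eps / (2 * c)) _)).
  by rewrite divr_gt0// mulr_gt0.
have h : 0 < eps / (2 * c) by rewrite divr_gt0// mulr_gt0.
have := mean_mul_points_in_ball Au (@bounded_measurable_cst _ _ A 1)
  (G := 1) (fun=> fun=> _) n0 h V.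
have := mean_weighted_points Au (X N) (e0 N) (fun=> 1).
rewrite sumr_const card_ord => ES; rewrite mean_cst// mulr1.
rewrite [X in `|X - _|](_ : _ = ball_density A * e N ^+ d * N%:R); last first.
  rewrite -ES; apply: eq_Rintegral => t _; rewrite mul1r.
  by apply: eq_bigr => j _; rewrite mul1r.
have en0 : 0 < e N ^+ d by rewrite exprn_gt0.
have N0 : 0 < N%:R :> R.
  by rewrite lt0r ler0n andbT; apply: contraTneq n0 => ->; rewrite mul0r ltxx.
rewrite -[ball_vol A _]/(c * e N ^+ d).
rewrite (_ : _ - _ = (ball_density A - c) * (N%:R * e N ^+ d)); last by ring.
rewrite normrM [X in _ * X]gtr0_norm ?mulr_gt0//.
rewrite (_ : 2 * 1 * _ * _ = eps * (N%:R * e N ^+ d)); last first.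
  by field; rewrite gt_eqF.
by rewrite ler_pM2r ?mulr_gt0// => k; apply: k; rewrite ler01 lexx.
Qed.

Lemma ball_count_le_radius (x y : 'cV[R]_d) (r r' : R) : r <= r' ->
  (ball_count A x r y <= ball_count A x r' y)%N.
Proof.
move=> rr'; apply: (@ball_count_leq _ _ _ Au id) => // v vr.
exact: le_trans rr'.
Qed.

(** * Two-sided bounds on the frequency for a fixed number of points *)

Section fixed_number.
Variables (N : nat) (e eta G : R) (x : 'cV[R]_d) (r : R).
Hypotheses (e0 : 0 < e) (n0 : 0 < N%:R * ball_vol A e) (eta0 : 0 < eta).
Hypothesis V :
  number_variance A (X N) e <= eta ^+ 2 * (N%:R * ball_vol A e) ^+ 2.
Hypothesis kc : ball_density A = c.
Hypothesis hG : forall t, Omega t -> (ball_count A (cV t) (r + e) x)%:R <= G.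

Lemma mean_ball_count_discrepancy (s : R) : 0 < s -> s <= r + e ->
  `|\int[domain_measure A]_(t in Omega)
      ((ball_count A (cV t) s x)%:R * points_in_ball A (X N) (cV t) e) -
    N%:R * ball_vol A e * (c * s ^+ d)| <= 2 * G * eta * (N%:R * ball_vol A e).
Proof.
move=> s0 sr; rewrite -kc -(mean_ball_count Au x s0).
apply: mean_mul_points_in_ball => //; first exact: bounded_measurable_ball_count.
move=> t Ot; rewrite ler0n/= (le_trans _ (hG Ot))// ler_nat.
exact: ball_count_le_radius.
Qed.

Let N0 : 0 < N%:R :> R.
Proof.
by rewrite lt0r ler0n andbT; apply: contraTneq n0 => ->; rewrite mul0r ltxx.
Qed.

(** The mean weight of one point and the factor in [N%:R * ball_vol A e] are both [c * e ^+ d]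
    thanks to [kc]; cancelling it leaves a bound in which [e] only enlarges the radius. *)
Lemma frequency_upper : 0 <= r ->
  N%:R^-1 * points_in_ball A (X N) x r <= c * (r + e) ^+ d + 2 * G * eta.
Proof.
move=> r0; have re : 0 < r + e by rewrite ltr_wpDl.
have := mean_ball_count_discrepancy re (lexx _); rewrite ler_distl => /andP[_ h].
have := le_trans (points_in_ball_upper Au (X N) e0 x r) h.
rewrite kc -[ball_vol A e]/(c * e ^+ d).
have k0 : 0 < c * e ^+ d by rewrite mulr_gt0 ?ball_vol_coef_gt0 ?exprn_gt0.
set k := c * e ^+ d in k0 *.
rewrite (_ : N%:R * k * _ + _ = k * (N%:R * (c * (r + e) ^+ d + 2 * G * eta))).
  by rewrite ler_pM2l// ler_pdivrMl.
by ring.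
Qed.

Lemma frequency_lower : e < r ->
  c * (r - e) ^+ d - 2 * G * eta <= N%:R^-1 * points_in_ball A (X N) x r.
Proof.
move=> er; have re : 0 < r - e by rewrite subr_gt0.
have := @mean_ball_count_discrepancy (r - e) re _.
rewrite ler_distl => /(_ _)/andP[|h _]; first by rewrite lerD2l ge0_cp// ltW.
have := le_trans h (points_in_ball_lower Au (X N) e0 x (r - e)).
rewrite subrK kc -[ball_vol A e]/(c * e ^+ d).
have k0 : 0 < c * e ^+ d by rewrite mulr_gt0 ?ball_vol_coef_gt0 ?exprn_gt0.
set k := c * e ^+ d in k0 *.
rewrite (_ : N%:R * k * _ - _ = k * (N%:R * (c * (r - e) ^+ d - 2 * G * eta))).
  by rewrite ler_pM2l// ler_pdivlMl.
by ring.
Qed.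

End fixed_number.

Lemma frequency_cvg (x : 'cV[R]_d) (r : R) : 0 <= r ->
  (fun N => N%:R^-1 * points_in_ball A (X N) x r) @ \oo --> ball_vol A r.
Proof.
move=> r0; have c0 := ball_vol_coef_gt0.
have [e [e0 e_cvg0 Ne]] := mesoscopic_radii R d0.
have n_cvg : (fun N => N%:R * ball_vol A (e N)) @ \oo --> +oo.
  have -> : (fun N => N%:R * ball_vol A (e N)) = (fun N => c * (N%:R * e N ^+ d)).
    by apply/funext => N; rewrite /ball_vol -/c; ring.
  move/cvgryPge : Ne => Ne; apply/cvgryPge => M; apply: filterS (Ne (M / c)) => N.
  by rewrite ler_pdivrMr// mulrC.
have small eta : 0 < eta -> \forall N \near \oo, 0 < N%:R * ball_vol A (e N) /\
    number_variance A (X N) (e N) <= eta ^+ 2 * (N%:R * ball_vol A (e N)) ^+ 2.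
  move=> eta0; near=> N.
  have n0 : 1 <= N%:R * ball_vol A (e N) by near: N; move/cvgryPge : n_cvg; exact.
  (* Once [n >= eta ^- 2], the bound [n] on the variance is itself at most [eta ^+ 2 * n ^+ 2]. *)
  have n1 : eta ^- 2 <= N%:R * ball_vol A (e N).
    by near: N; move/cvgryPge : n_cvg; exact.
  have Vn : `|number_variance A (X N) (e N)| <= 1 * `|N%:R * ball_vol A (e N)|.
    by near: N; have /eqoP := hyp e0 e_cvg0 n_cvg; exact.
  set n := N%:R * ball_vol A (e N) in n0 n1 Vn *.
  have n_gt0 : 0 < n by exact: lt_le_trans n0.
  split => //; apply: (le_trans (ler_norm _)); apply: (le_trans Vn).
  rewrite mul1r gtr0_norm//.
  have : 1 * n <= eta ^+ 2 * n * n.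
    apply: ler_wpM2r; first exact: ltW.
    by rewrite -ler_pdivrMl ?exprn_gt0// mulr1.
  by rewrite mul1r -mulrA -expr2.
have kc := ball_vol_density e0 small.
(* Radius [r + 1] covers [r + e N] as soon as [e N <= 1], so [G], and with it [eta], is fixed before
   [N]. *)
have [G hG] := ball_count_bounded Au x (r + 1).
have cont : continuous (fun s : R => c * s ^+ d).
  move=> s; apply: cvgM; first exact: cvg_cst.
  exact: exprn_continuous.
apply/cvgrPdist_le => eps eps0.
(* Half of [eps] pays for [2 * G * eta], the other half for the change of radius; [+ 1] keeps the
   denominator nonzero. *)
have eta0 : 0 < eps / (4 * (`|G| + 1)).
  by rewrite divr_gt0// mulr_gt0// ltr_wpDl.
set eta := eps / _ in eta0.
have Geta : 2 * G * eta <= eps / 2.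
  rewrite (_ : eps / 2 = 2 * (`|G| + 1) * eta); last first.
    by rewrite /eta; field; rewrite gt_eqF// ltr_wpDl.
  by rewrite ler_wpM2r ?(ltW eta0)// ler_wpM2l// (le_trans (ler_norm G))// lerDl.
have up : (fun N => c * (r + e N) ^+ d) @ \oo --> c * r ^+ d.
  apply: (@cvg_comp _ _ _ _ (fun s => c * s ^+ d) _ (nbhs r)); last exact: cont.
  have : (fun N => r + e N) @ \oo --> r + 0.
    by apply: cvgD => //; exact: cvg_cst.
  by rewrite addr0.
have lo : (fun N => c * (r - e N) ^+ d) @ \oo --> c * r ^+ d.
  apply: (@cvg_comp _ _ _ _ (fun s => c * s ^+ d) _ (nbhs r)); last exact: cont.
  have : (fun N => r - e N) @ \oo --> r - 0.
    by apply: cvgB => //; exact: cvg_cst.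
  by rewrite subr0.
have eps2 : 0 < eps / 2 by rewrite divr_gt0.
have e_lt : \forall N \near \oo, 0 < r -> e N < r.
  have [r_gt0|_] := ltP 0 r; last exact: nearW.
  by apply: filterS (cvgr_lt (0 : R) e_cvg0 _ r_gt0) => N ? _.
near=> N.
have [n0 V] : 0 < N%:R * ball_vol A (e N) /\
    number_variance A (X N) (e N) <= eta ^+ 2 * (N%:R * ball_vol A (e N)) ^+ 2.
  by near: N; exact: small.
have eN1 : e N <= 1.
  by near: N; apply: (cvgr_le (0 : R)) => //.
have hGN t : Omega t -> (ball_count A (cV t) (r + e N) x)%:R <= G.
  move=> Ot; apply: le_trans (hG t Ot); rewrite ler_nat.
  by apply: ball_count_le_radius; rewrite lerD2l.
have uN : `|c * r ^+ d - c * (r + e N) ^+ d| <= eps / 2.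
  by near: N; move/cvgrPdist_le : up; exact.
have lN : `|c * r ^+ d - c * (r - e N) ^+ d| <= eps / 2.
  by near: N; move/cvgrPdist_le : lo; exact.
have eNr : 0 < r -> e N < r by near: N; exact: e_lt.
rewrite -[ball_vol A r]/(c * r ^+ d) distrC ler_distl; apply/andP; split.
  (* At [r = 0] the radius cannot be shrunk, but [0 ^+ d = 0] for [d > 0] and the lower bound is
     nonnegativity of the count. *)
  have [r_gt0|r_le0] := ltP 0 r; last first.
    have -> : r = 0 by apply/eqP; rewrite eq_le r_le0.
    rewrite expr0n gtn_eqF// mulr0 sub0r (@le_trans _ _ 0)//.
      by rewrite oppr_le0 ltW.
    by rewrite mulr_ge0 ?invr_ge0// sumr_ge0.
  have := frequency_lower (e0 N) n0 eta0 V kc hGN (eNr r_gt0).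
  by move: lN; rewrite ler_distl => /andP[l1 l2] l3; lra.
have := frequency_upper (e0 N) n0 eta0 V kc hGN r0.
by move: uN; rewrite ler_distl => /andP[u1 u2] u3; lra.
Unshelve. all: by end_near. Qed.

End main.

Theorem theorem3p2 (R : realType) (d : nat) (A : 'M[R]_d)
    (X : forall N : nat, 'I_N -> 'cV[R]_d) :
  A \in unitmx ->
  point_sets A X ->
  hyperuniform_small_balls A X ->
  uniformly_distributed A X.
Proof.
move=> Au XO hX x r /andP[r0 _].
(* In dimension 0 there is only one vector, so the two points of [X 2] could not be distinct. *)
have d0 : (0 < d)%N.
  case: d A X Au XO {hX x} => // A X _ /(_ 2%N)[X_inj _].
  have /X_inj : X 2%N ord0 = X 2%N ord_max by apply/colP => -[].
  by move/(congr1 val).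
exact: frequency_cvg.
Qed.
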